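(* Let $v:\{0,1\}^n\to\mathbb R$ be a gross-substitute valuation, and let $$v^+(\mathbf x):=\max\Big\{\sum_{S\subseteq[n]}v(S)\lambda_S:\ \sum_S\lambda_S\mathbf 1_S=\mathbf x,\ \sum_S\lambda_S=1,\ \lambda_S\ge0\Big\},\qquad \mathbf x\in[0,1]^n,$$ be the concave closure of $v$. Then $v^+:[0,1]^n\to\mathbb R$ is linear substitute.
   Context: $v(S)$ and $v(\mathbf 1_S)$ are used interchangeably, where $\mathbf 1_S$ is the characteristic vector of $S$. Gross substitutes (GS): for a set function $v$ and price vector $\mathbf q\in\mathbb R_{\ge0}^n$ let $\mathcal D(v,\mathbf q)=\arg\max_{X\subseteq[n]}\{v(X)-\mathbf q\cdot\mathbf 1_X\}$. $v$ is GS if for any $\mathbf q'\ge\mathbf q\ge0$ and any $X\in\mathcal D(v,\mathbf q)$ there is $Y\in\mathcal D(v,\mathbf q')$ with $X\cap\{j:q_j=q'_j\}\subseteq Y$. Linear substitute (LS): for $v:\prod_{i\in[n]}[0,L_i]\to\mathbb R$ let $\mathcal D(v,\mathbf q)=\arg\max_{\mathbf x}\{v(\mathbf x)-\mathbf q\cdot\mathbf x\}$. $v$ is LS if for all price vectors $\mathbf q,\mathbf q'\in\mathbb R^n_{\ge0}$ with $q_j\le q'_j$ for one index $j$ and $q_k=q'_k$ for all $k\ne j$, and every $X\in\mathcal D(v,\mathbf q)$, there is $Y\in\mathcal D(v,\mathbf q')$ with $Y_k\ge X_k$ for all $k\ne j$. *)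

(* Defs.v *)
From mathcomp Require Import all_boot all_order all_algebra.
From mathcomp Require Import all_classical all_reals all_analysis.

Set Implicit Arguments.
Unset Strict Implicit.
Unset Printing Implicit Defensive.

Import Order.TTheory GRing.Theory Num.Theory.
Import numFieldNormedType.Exports.

Local Open Scope classical_set_scope.
Local Open Scope ring_scope.

Definition argmax (R : realType) (T : Type) (D : set T) (f : T -> R) : set T :=
  [set x | D x /\ forall y, D y -> f y <= f x].

Definition dot (R : realType) (n : nat) (q x : 'rV[R]_n) : R :=
  \sum_j q 0 j * x 0 j.

Definition char_vec (R : realType) (n : nat) (S : {set 'I_n}) : 'rV[R]_n :=
  \row_j (j \in S)%:R.

Definition box (R : realType) (n : nat) (L : 'rV[R]_n) : set 'rV[R]_n :=
  [set x | forall j, 0 <= x 0 j <= L 0 j].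

Definition set_demand (R : realType) (n : nat) (v : {set 'I_n} -> R)
    (q : 'rV[R]_n) : set {set 'I_n} :=
  argmax setT (fun X => v X - dot q (char_vec R X)).

Definition gross_substitute (R : realType) (n : nat)
    (v : {set 'I_n} -> R) : Prop :=
  forall q q' : 'rV[R]_n,
    (forall j, 0 <= q 0 j) -> (forall j, q 0 j <= q' 0 j) ->
  forall X, set_demand v q X ->
  exists2 Y, set_demand v q' Y &
    forall j, j \in X -> q 0 j = q' 0 j -> j \in Y.

(* Here and in [linear_substitute], [f] stands for a function on [box L] only:
   its values outside [box L] are never used. *)
Definition box_demand (R : realType) (n : nat) (L : 'rV[R]_n)
    (f : 'rV[R]_n -> R) (q : 'rV[R]_n) : set 'rV[R]_n :=
  argmax (box L) (fun x => f x - dot q x).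

Definition linear_substitute (R : realType) (n : nat) (L : 'rV[R]_n)
    (f : 'rV[R]_n -> R) : Prop :=
  forall (q q' : 'rV[R]_n) (j : 'I_n),
    (forall k, 0 <= q 0 k) -> (forall k, 0 <= q' 0 k) ->
    q 0 j <= q' 0 j -> (forall k, k != j -> q 0 k = q' 0 k) ->
  forall X, box_demand L f q X ->
  exists2 Y, box_demand L f q' Y & forall k, k != j -> X 0 k <= Y 0 k.

Definition convex_decomp (R : realType) (n : nat) (x : 'rV[R]_n) :
    set ({set 'I_n} -> R) :=
  [set w | [/\ \sum_S w S *: char_vec R S = x,
               \sum_S w S = 1 & forall S, 0 <= w S]].

(* On the unit cube this supremum is a maximum: see [concave_closure_max]. *)
Definition concave_closure (R : realType) (n : nat) (v : {set 'I_n} -> R)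
    (x : 'rV[R]_n) : R :=
  sup [set \sum_S v S * w S | w in convex_decomp x].

Lemma convex_decomp_nonempty (R : realType) (n : nat) (x : 'rV[R]_n) :
  box (const_mx 1) x -> convex_decomp x !=set0.
Proof.
move=> hx; pose f (i : 'I_n) (b : bool) := if b then x 0 i else 1 - x 0 i.
have E (F G : 'I_n -> R) : \sum_(S : {set 'I_n})
    \prod_i (if i \in S then F i else G i) = \prod_i (F i + G i).
  by rewrite bigA_distr.
exists (fun S : {set 'I_n} => \prod_i f i (i \in S)); split.
- apply/rowP => j; rewrite summxE.
  pose F i := x 0 i; pose G i := if i == j then 0 else 1 - x 0 i.
  transitivity (\sum_(S : {set 'I_n})
      \prod_i (if i \in S then F i else G i)).
    apply: eq_bigr => S _; rewrite !mxE; have [jS|jS] := boolP (j \in S).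
      rewrite mulr1; apply: eq_bigr => i _; rewrite /f /F /G.
      by case: (boolP (i \in S)) => // iS; case: eqP iS => // ->; rewrite jS.
    by rewrite mulr0 (bigD1 j) //= (negbTE jS) /G eqxx mul0r.
  rewrite E (bigD1 j) //= /F /G eqxx addr0 big1 ?mulr1 // => i /negbTE ->.
  by rewrite addrC subrK.
- by rewrite E big1 // => i _; rewrite addrC subrK.
- move=> S; apply: prodr_ge0 => i _; rewrite /f.
  by have := hx i; rewrite mxE => /andP[? ?]; case: ifP; rewrite ?subr_ge0.
Qed.

Lemma concave_closure_max (R : realType) (n : nat) (v : {set 'I_n} -> R)
    (x : 'rV[R]_n) : box (const_mx 1) x ->
  exists2 w, convex_decomp x w &
    concave_closure v x = \sum_S v S * w S /\
    forall w', convex_decomp x w' -> \sum_S v S * w' S <= \sum_S v S * w S.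
Proof.
move=> hx; pose T := prod_topology (fun _ : {set 'I_n} => R : topologicalType).
have ct (c : {set 'I_n} -> R) : continuous (fun w : T => \sum_S c S * w S).
  apply: continuous_big; first exact: add_continuous.
  move=> S _ w.
  have p : {for w, continuous (fun u : T => u S)}.
    exact: (@proj_continuous _ (fun _ : {set 'I_n} => R : topologicalType) S).
  exact: (@continuousM R T (fun=> c S) (fun u : T => u S) w
            (@cst_continuous _ _ (c S) w) p).
have Tc : compact [set w : T | forall S : {set 'I_n}, w S \in `[0 : R, 1]].
  apply: (@tychonoff _ (fun _ : {set 'I_n} => R : topologicalType)
    (fun _ => `[0 : R, 1]%classic)) => S; exact: segment_compact.
have cl (c : {set 'I_n} -> R) (y : R) : closed [set w : T | \sum_S c S * w S = y].
  have := @preimage_closed _ _ (fun w : T => \sum_S c S * w S) [set y].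
  apply; last exact: closed_eq.
  by move=> w _; exact: ct.
have cD : compact (convex_decomp x : set T).
  have -> : convex_decomp x = [set w : T | forall S : {set 'I_n}, w S \in `[0 : R, 1]]
     `&` ([set w : T | \sum_S 1 * w S = 1] `&`
      \bigcap_(j in [set: 'I_n]) [set w : T | \sum_S (char_vec R S 0 j) * w S = x 0 j]).
    apply/seteqP; split => w /=.
      case=> ex e1 w0; split.
        move=> S; rewrite in_itv /= w0 /= -e1 (bigD1 S) //= lerDl.
        by apply: sumr_ge0.
      split; first by under eq_bigr do rewrite mul1r.
      move=> j _ /=; rewrite -ex summxE; apply: eq_bigr => S _.
      by rewrite !mxE mulrC.
    move=> [w01 [e1 ej]]; split.
    - apply/rowP => j; rewrite summxE -(ej j) //.
      by apply: eq_bigr => S _; rewrite !mxE mulrC.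
    - by rewrite -e1; apply: eq_bigr => S _; rewrite mul1r.
    - by move=> S; have := w01 S; rewrite in_itv /= => /andP[].
  apply: compact_closedI => //; apply: closedI; first exact: cl.
  by apply: closed_bigI => j _; exact: cl.
have [w wD wmax] := @compact_EVT_max T R (fun w => \sum_S v S * w S) _
  (convex_decomp_nonempty hx) cD (continuous_subspaceT (ct v)).
have {}wD : convex_decomp x w by rewrite inE in wD.
have ub w' : convex_decomp x w' -> \sum_S v S * w' S <= \sum_S v S * w S.
  by move=> h; apply: wmax; rewrite inE.
exists w => //; split => //; apply/le_anti/andP; split.
  apply: ge_sup; first by exists (\sum_S v S * w S), w.
  by move=> _ [w' /ub + <-].
apply: ub_le_sup; last by exists w.
by exists (\sum_S v S * w S) => _ [w' /ub + <-].
Qed.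

(* Main.v *)
(** A bundle is demanded under the concave closure exactly when it is a convex
    combination of demanded sets.  Applying gross substitutes to each set of such
    a combination, and keeping the weights, yields the required bundle at the
    raised price. *)
Require Import Defs.
From mathcomp Require Import all_boot all_order all_algebra.
From mathcomp Require Import all_classical all_reals all_analysis.

Set Implicit Arguments.
Unset Strict Implicit.
Unset Printing Implicit Defensive.

Import Order.TTheory GRing.Theory Num.Theory.

Local Open Scope ring_scope.

Lemma convex_decomp_box (R : realType) (n : nat) (x : 'rV[R]_n) w :
  convex_decomp x w -> box (const_mx 1) x.
Proof.
move=> [<- w1 w0] j; rewrite mxE summxE; apply/andP; split.
  by apply: sumr_ge0 => S _; rewrite !mxE mulr_ge0.
rewrite -w1; apply: ler_sum => S _; rewrite !mxE.
by rewrite ler_piMr // lern1 leq_b1.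
Qed.

Lemma convex_decomp_char_vec (R : realType) (n : nat) (S : {set 'I_n}) :
  convex_decomp (char_vec R S) (fun T => (T == S)%:R).
Proof.
split=> [||T]; last by [].
- by rewrite (bigD1 S) //= eqxx scale1r big1 ?addr0 // => T /negbTE ->; rewrite scale0r.
- by rewrite (bigD1 S) //= eqxx big1 ?addr0 // => T /negbTE ->.
Qed.

(** As [g] need not be injective, sets with a common image pool their weights. *)
Lemma convex_decomp_pushforward (R : realType) (n : nat) (x : 'rV[R]_n) w
    (g : {set 'I_n} -> {set 'I_n}) : convex_decomp x w ->
  convex_decomp (\sum_S w S *: char_vec R (g S))
    (fun T => \sum_(S | g S == T) w S).
Proof.
move=> [_ w1 w0]; split=> [||T]; last exact: sumr_ge0.
- rewrite [RHS](partition_big g xpredT) //=; apply: eq_bigr => T _.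
  by rewrite scaler_suml; apply: eq_bigr => S /eqP ->.
- by rewrite -w1 [RHS](partition_big g xpredT).
Qed.

(** Price is linear in the bundle, so it splits over the decomposition and utility becomes an
    average over sets. *)
Lemma sub_dot_convex_decomp (R : realType) (n : nat) (v : {set 'I_n} -> R)
    (q x : 'rV[R]_n) w : convex_decomp x w ->
  \sum_S v S * w S - dot q x = \sum_S w S * (v S - dot q (char_vec R S)).
Proof.
move=> [<- _ _]; have -> : dot q (\sum_S w S *: char_vec R S)
    = \sum_S w S * dot q (char_vec R S).
  rewrite /dot; under eq_bigr do rewrite summxE mulr_sumr.
  rewrite exchange_big; apply: eq_bigr => S _; rewrite mulr_sumr.
  by apply: eq_bigr => j _; rewrite !mxE mulrCA.
by rewrite -sumrB; apply: eq_bigr => S _; rewrite mulrBr mulrC.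
Qed.

Lemma concave_closure_ge (R : realType) (n : nat) (v : {set 'I_n} -> R)
    (x : 'rV[R]_n) w : convex_decomp x w ->
  \sum_S v S * w S <= concave_closure v x.
Proof.
move=> xw; have [w' _ [-> +]] := concave_closure_max v (convex_decomp_box xw).
exact.
Qed.

(** An average of set utilities never exceeds the largest one, and it reaches that value exactly
    when no weight falls on a set of lower utility. *)
Lemma box_demand_concave_closureP (R : realType) (n : nat)
    (v : {set 'I_n} -> R) (q x : 'rV[R]_n) :
  box_demand (const_mx 1) (concave_closure v) q x <->
  exists2 w, convex_decomp x w & forall S, w S != 0 -> set_demand v q S.
Proof.
pose U S := v S - dot q (char_vec R S); split.
- move=> [xbox xmax]; have [w xw [xE _]] := concave_closure_max v xbox.
  exists w => // S wS; have [_ w1 w0] := xw.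
  (* [S0] has maximal utility, and [U S0 - U T] is the gap of [T]. Optimality of [x] against the
     vertex [char_vec R S0] makes the average gap nonpositive. *)
  have [S0 _ S0max] : exists2 S0, true & forall T, U T <= U S0.
    by have [S0 _ S0max] := @arg_maxP _ _ _ finset.set0 xpredT U isT; exists S0 => // T; exact: S0max.
  have gap0 T : 0 <= w T * (U S0 - U T) by rewrite mulr_ge0 ?subr_ge0.
  have : \sum_T w T * (U S0 - U T) <= 0.
    under eq_bigr do rewrite mulrBr.
    rewrite sumrB -mulr_suml w1 mul1r subr_le0 /U -(sub_dot_convex_decomp _ _ xw).
    have cS0 := convex_decomp_char_vec R S0.
    rewrite -xE; apply: le_trans (xmax _ (convex_decomp_box cS0)).
    rewrite lerD2r; apply: le_trans (concave_closure_ge v cS0).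
    rewrite (bigD1 S0) //= eqxx mulr1 big1 ?addr0 // => T /negbTE ->.
    by rewrite mulr0.
  (* The nonnegative terms have sum zero, so each vanishes; as [w S] is nonzero, [S] has no gap. *)
  rewrite le_eqVlt ltNge sumr_ge0 // orbF psumr_eq0 // => /allP/(_ S).
  rewrite mem_index_enum => /(_ isT); rewrite mulf_eq0 (negbTE wS) subr_eq0.
  by move=> /eqP US; split=> // T _; rewrite -/(U T) -/(U S) -US.
- move=> [w xw wdem]; split=> [|y ybox]; first exact: convex_decomp_box xw.
  have [u yu [-> _]] := concave_closure_max v ybox.
  apply: (@le_trans _ _ (\sum_S v S * w S - dot q x)); last first.
    by rewrite lerD2r concave_closure_ge.
  rewrite (sub_dot_convex_decomp _ _ xw) (sub_dot_convex_decomp _ _ yu).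
  have [_ w1 w0] := xw; have [_ u1 u0] := yu.
  (* Both families of weights sum to 1, so the two averages can be compared pair by pair: a demanded
     [S] does at least as well as any [T]. *)
  rewrite -[leLHS]mul1r -w1 mulr_suml; apply: ler_sum => S _.
  have [->|/wdem[_ Smax]] := eqVneq (w S) 0; first by rewrite !mul0r.
  apply: ler_wpM2l => //; rewrite -[leRHS]mul1r -u1 mulr_suml.
  by apply: ler_sum => T _; apply: ler_wpM2l => //; exact: Smax.
Qed.

Theorem theorem2p15 (R : realType) (n : nat) (v : {set 'I_n} -> R)
  (hv : gross_substitute v) :
  linear_substitute (const_mx 1 : 'rV[R]_n) (concave_closure v).
Proof.
move=> q q' j q0 q'0 qj qk X /box_demand_concave_closureP[w Xw wdem].
have [g gP] : {g : {set 'I_n} -> {set 'I_n} & forall S, w S != 0 ->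
    set_demand v q' (g S) /\ forall k, k != j -> k \in S -> k \in g S}.
  apply: (@choice _ _ (fun S T => w S != 0 -> set_demand v q' T /\
    forall k, k != j -> k \in S -> k \in T)) => S.
  (* A set of weight zero may fail to be demanded; the empty set is a mere placeholder for its
     image. *)
  have [_|/wdem Sdem] := eqVneq (w S) 0; first by exists finset.set0.
  have [|T Tdem ST] := hv q q' q0 _ S Sdem.
    by move=> k; have [->//|/qk->] := eqVneq k j.
  by exists T => _; split=> // k /qk qqk kS; exact: ST.
exists (\sum_S w S *: char_vec R (g S)).
  apply/box_demand_concave_closureP; eexists.
    exact: convex_decomp_pushforward Xw.
  (* Either [T] is the image of a set of nonzero weight, hence demanded, or its whole fibre has
     weight zero. *)
  move=> T; have [/existsP[S /andP[/eqP <- /gP[]]]//|] :=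
    boolP [exists S, (g S == T) && (w S != 0)].
  rewrite negb_exists => /forallP none; rewrite big1 ?eqxx // => S gS.
  by apply/eqP; have := none S; rewrite gS /= negbK.
(* [X] and the new bundle share the weights [w], so coordinate [k] is compared set by set. *)
move=> k kj; have [<- _ w0] := Xw; rewrite !summxE; apply: ler_sum => S _.
rewrite !mxE; have [->|/gP[_ /(_ k kj) Sg]] := eqVneq (w S) 0.
  by rewrite !mul0r.
rewrite ler_wpM2l // ler_nat; case: (k \in S) Sg => // -> //.
Qed.
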